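(* Let $C\subseteq\mathbb{Z}^2$ be a $(1,\leq 2)$-identifying code of the king grid. Then its density satisfies $D(C)\geq \frac{47}{111}$.
   Context: The king grid is the graph with vertex set $\mathbb{Z}^2$ in which two distinct vertices are adjacent if and only if their Euclidean distance is at most $\sqrt{2}$. For a vertex $v$, $N[v]$ denotes its closed neighbourhood ($v$ together with all adjacent vertices; nine vertices in the king grid), and $N[X]=\bigcup_{v\in X}N[v]$ for a set $X$ of vertices. A set $C\subseteq\mathbb{Z}^2$ is a $(1,\leq 2)$-identifying code of the king grid if $N[X]\cap C\neq N[Y]\cap C$ for any two distinct subsets $X,Y\subseteq\mathbb{Z}^2$ of size at most $2$ (one of them may be empty). The density of $C\subseteq\mathbb{Z}^2$ is $D(C)=\limsup_{n\to\infty}\frac{|C\cap Q_n|}{|Q_n|}$, where $Q_n=\{(x,y)\in\mathbb{Z}^2 : |x|\leq n,\ |y|\leq n\}$. *)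

(* Defs.v *)
From HB Require Import structures.
From mathcomp Require Import all_boot all_order all_algebra finmap.
From mathcomp Require Import all_classical all_reals all_analysis.

Set Implicit Arguments.
Unset Strict Implicit.
Unset Printing Implicit Defensive.

Import Order.TTheory GRing.Theory Num.Theory.

Local Open Scope classical_set_scope.
Local Open Scope card_scope.
Local Open Scope ring_scope.

Section IdentifyingCodes.
Variables (V : Type) (adj : V -> V -> Prop).

Definition closed_nbhd (v : V) : set V := [set w | w = v \/ adj v w].

Definition closed_nbhd_set (X : set V) : set V :=
  \bigcup_(v in X) closed_nbhd v.

(* (1, <= l)-identifying code; the empty set is one of the sets to be told
   apart from the others. *)
Definition identifying_code (l : nat) (C : set V) : Prop :=
  forall X Y : set V, X #<= `I_l -> Y #<= `I_l -> X <> Y ->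
    closed_nbhd_set X `&` C <> closed_nbhd_set Y `&` C.

End IdentifyingCodes.

Definition euclid_dist (R : realType) (u v : int * int) : R :=
  Num.sqrt ((u.1 - v.1)%:~R ^+ 2 + (u.2 - v.2)%:~R ^+ 2).

Definition king_adj (R : realType) (u v : int * int) : Prop :=
  u <> v /\ euclid_dist R u v <= Num.sqrt 2.

Definition square (n : nat) : set (int * int) :=
  [set v | `|v.1| <= n%:Z /\ `|v.2| <= n%:Z].

(* [fset_set] is meaningful only on finite sets. *)
Lemma finite_square n : finite_set (square n).
Proof.
pose f (p : nat * nat) : int * int := (p.1%:Z - n%:Z, p.2%:Z - n%:Z).
apply: (@sub_finite_set _ _ (f @` (`I_(n + n)%N.+1 `*` `I_(n + n)%N.+1))).
  move=> [x y] /= [/=]; rewrite !ler_norml => /andP[x1 x2] /andP[y1 y2].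
  have hx : 0 <= x + n%:Z by rewrite -lerBlDr sub0r.
  have hy : 0 <= y + n%:Z by rewrite -lerBlDr sub0r.
  exists (absz (x + n%:Z), absz (y + n%:Z)) => /=; last first.
    by rewrite /f /= !gez0_abs// !addrK.
  by split; rewrite /= ltnS -lez_nat gez0_abs// PoszD lerD2r.
apply: finite_image; apply: finite_setX; exact: finite_II.
Qed.

Definition density (R : realType) (C : set (int * int)) : \bar R :=
  limn_esup (fun n : nat =>
    ((#|` fset_set (C `&` square n)|)%:R /
     (#|` fset_set (square n)|)%:R)%:E).

(* Main.v *)
Require Import Defs.
From Stdlib Require Import NArith.
From mathcomp Require Import all_boot all_order all_algebra finmap.
From mathcomp Require Import all_classical all_reals all_analysis.
From mathcomp Require Import zify.

(** Three consecutive vertices of a row or column cannot all miss [C], and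
    neither can the four corners of a 4x4 square.  These local conditions
    already force the density: give the cells of a window of 13 columns and 5
    rows suitable weights of total 1506; then the cells outside [C] weigh at
    most 868, so the cells of [C] weigh at least 638, in every translate of the
    window.  Averaging over the translates gives density at least
    638/1506 > 47/111.  The bound 868 is the result of a dynamic program that
    scans the window column by column and remembers only what the local
    conditions can still see of the last three columns. *)

Set Implicit Arguments.
Unset Strict Implicit.
Unset Printing Implicit Defensive.

Import Order.TTheory GRing.Theory Num.Theory.

(** * Memo tables indexed by bit sequences *)

(* [lookup (tabulate n f)] is [f] on bit sequences of length [n], with all
   values computed once: this is how the dynamic program memoizes. *)
Inductive trie (T : Type) : Type := Leaf of T | Node of trie T & trie T.

Fixpoint tabulate (T : Type) (n : nat) (f : seq bool -> T) : trie T :=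
  if n is m.+1 then
    Node (tabulate m (fun s => f (false :: s)))
         (tabulate m (fun s => f (true :: s)))
  else Leaf (f [::]).

Arguments tabulate : simpl never.

Fixpoint lookup (T : Type) (t : trie T) (s : seq bool) : T :=
  match t with
  | Leaf x => x
  | Node l r => lookup (if head false s then r else l) (behead s)
  end.

Lemma lookup_tabulate (T : Type) n (f : seq bool -> T) s :
  size s = n -> lookup (tabulate n f) s = f s.
Proof.
by elim: n f s => [|n IHn] f [|[] s] //= [sz]; exact: IHn.
Qed.

Arguments lookup : simpl never.

Fixpoint bitseqs (n : nat) : seq bitseq :=
  if n is m.+1 then map (cons false) (bitseqs m) ++ map (cons true) (bitseqs m)
  else [:: [::]].

Lemma mem_bitseqs s : s \in bitseqs (size s).
Proof.
elim: s => [|b s IHs] //=; rewrite mem_cat.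
by case: b; rewrite map_f ?orbT.
Qed.

(** * The dynamic program over columns *)

(* From here on a bit sequence is a column of the window, [true] marking the
   cells outside the code.  The conditionals replace [&&] because [vm_compute]
   evaluates both arguments of [andb]. *)
Fixpoint disjoint3 (b c d : bitseq) : bool :=
  match b, c, d with
  | x :: b', y :: c', z :: d' =>
      if [&& x, y & z] then false else disjoint3 b' c' d'
  | _, _, _ => true
  end.

Definition no_run3 (c : bitseq) : bool := disjoint3 c (drop 1 c) (drop 2 c).

(* [true] at [i] when cells [i] and [i + 3] are both outside the code, that is,
   when they are one side of a 4x4 square of corners outside the code. *)
Definition gap3 (c : bitseq) : bitseq :=
  [seq x.1 && x.2 | x <- zip c (drop 3 c)].

Fixpoint disjoint2 (a d : bitseq) : bool :=
  match a, d with
  | x :: a', y :: d' => if x && y then false else disjoint2 a' d'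
  | _, _ => true
  end.

Fixpoint weight (w : seq N) (c : bitseq) : N :=
  match w, c with
  | k :: w', x :: c' => N.add (if x then k else 0%num) (weight w' c')
  | _, _ => 0%num
  end.

Definition columns : seq bitseq := [seq c <- bitseqs 5 | no_run3 c].

(* [s] is [b ++ c ++ gap3 a], where [a], [b], [c] are the last three columns,
   and [d] is the next one. *)
Definition step (w : seq N) (V : bitseq -> N) (s : bitseq) : N :=
  let b := take 5 s in
  let c := take 5 (drop 5 s) in
  let m := drop 10 s in
  foldr (fun d acc =>
      if disjoint3 b c d then
        if disjoint2 m (gap3 d) then
          N.max (weight w d + V (c ++ d ++ gap3 b)) acc
        else acc
      else acc)
    0%num columns.

Fixpoint best (ws : seq (seq N)) : trie N :=
  if ws is w :: ws' then
    let t := best ws' in tabulate 12 (step w (lookup t))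
  else Leaf 0%num.

(** Columns 0, 1 and 2 lie to the left of the window and only supply the starting state. *)
Fixpoint total (ws : seq (seq N)) (f : nat -> bitseq) : N :=
  if ws is w :: ws' then N.add (weight w (f 3)) (total ws' (fun j => f j.+1))
  else 0%num.

Record admissible (f : nat -> bitseq) : Prop := Admissible {
  column_size : forall j, size (f j) = 5;
  column_run3 : forall j, no_run3 (f j);
  row_run3 : forall j, disjoint3 (f j) (f j.+1) (f j.+2);
  corners : forall j, disjoint2 (gap3 (f j)) (gap3 (f j.+3)) }.

Lemma size_gap3 c : size c = 5 -> size (gap3 c) = 2.
Proof. by move=> sz; rewrite size_map size_zip size_drop sz. Qed.

(** The true next column [f 3] is one of the candidates of [step] and passes both tests, so the
    maximum dominates its term; the rest is the induction hypothesis for [f] shifted by one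
    column. *)
Lemma total_le_best ws f : admissible f ->
  (total ws f <= lookup (best ws) (f 1 ++ f 2 ++ gap3 (f 0)))%num.
Proof.
elim: ws f => [|w ws IHws] f adm /=; first exact: N.le_refl.
have [sz run row cor] := adm.
rewrite lookup_tabulate; last by rewrite !size_cat !sz size_gap3.
rewrite /step take_size_cat// drop_size_cat// take_size_cat//.
rewrite catA drop_size_cat ?size_cat ?sz//.
have : f 3 \in columns.
  by rewrite mem_filter run -{1}(sz 3) mem_bitseqs.
have {IHws} := IHws (fun j => f j.+1) (Admissible
  (fun j => sz j.+1) (fun j => run j.+1)
  (fun j => row j.+1) (fun j => cor j.+1)).
elim: columns => [//|d cs IHcs] IHws.
rewrite inE => /predU1P[<-|/IHcs {}IHcs] /=.
  rewrite row cor; apply: N.le_trans (N.le_max_l _ _).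
  exact: N.add_le_mono (N.le_refl _) IHws.
case: ifP => _; last exact: IHcs.
case: ifP => _; last exact: IHcs.
apply: N.le_trans (N.le_max_r _ _); exact: IHcs.
Qed.

(* The weights come from solving numerically the linear program that maximizes
   the guaranteed share of the code, and rounding. *)
Definition edge_row :=
  [:: 3; 8; 16; 24; 33; 41; 42; 41; 33; 24; 16; 8; 3]%num.
Definition side_row :=
  [:: 3; 11; 19; 27; 32; 40; 38; 40; 32; 27; 19; 11; 3]%num.
Definition middle_row :=
  [:: 3; 11; 19; 27; 32; 45; 44; 45; 32; 27; 19; 11; 3]%num.

Definition window : seq (seq N) :=
  [seq [:: x.1.1; x.1.2; x.2; x.1.2; x.1.1]
    | x <- zip (zip edge_row side_row) middle_row].

(** All 4096 starting states are checked, so nothing need be known about which of them occur. *)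
Lemma best_window :
  let t := best window in all (fun s => N.leb (lookup t s) 868) (bitseqs 12).
Proof. by vm_compute. Qed.

Lemma total_window f : admissible f -> (total window f <= 868)%num.
Proof.
move=> adm; apply: N.le_trans (total_le_best adm) _.
apply/N.leb_le; apply: (allP best_window).
have -> : 12 = size (f 1 ++ f 2 ++ gap3 (f 0)); last exact: mem_bitseqs.
by case: adm => sz *; rewrite !size_cat !sz size_gap3.
Qed.

Lemma nat_of_binD (a b : N) : N.add a b = a + b :> nat.
Proof. lia. Qed.

Lemma weight_sum w c : size w = size c ->
  weight w c = \sum_(i < size w) nth false c i * nth 0%num w i :> nat.
Proof.
elim: w c => [|k w IHw] [|x c] //=; first by rewrite big_ord0.
case=> sz; rewrite big_ord_recl/= nat_of_binD IHw//.
by case: x; rewrite ?mul1n ?mul0n.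
Qed.

Lemma total_sum ws f :
  all (fun w => size w == 5) ws -> (forall j, size (f j) = 5) ->
  total ws f = \sum_(j < size ws) \sum_(i < 5)
    nth false (f (j + 3)) i * nth 0%num (nth [::] ws j) i :> nat.
Proof.
elim: ws f => [|w ws IHws] f /=; first by rewrite big_ord0.
move=> /andP[/eqP szw szs] sz; rewrite big_ord_recl/= nat_of_binD IHws//.
by rewrite weight_sum ?szw ?sz.
Qed.

(** * Local conditions on an identifying code *)

Local Open Scope classical_set_scope.
Local Open Scope card_scope.
Local Open Scope ring_scope.

(** Turns neighbourhoods into 3x3 squares given by linear inequalities, within reach of [lia]. *)
Lemma king_nbhd (R : realType) (v w : int * int) :
  closed_nbhd (king_adj R) v w <->
  [&& v.1 - 1 <= w.1, w.1 <= v.1 + 1, v.2 - 1 <= w.2 & w.2 <= v.2 + 1].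
Proof.
case: v w => [v1 v2] [w1 w2]; rewrite /closed_nbhd /king_adj /euclid_dist /=.
have -> : (Num.sqrt (((v1 - w1)%:~R : R) ^+ 2 + (v2 - w2)%:~R ^+ 2)
      <= Num.sqrt 2) = ((v1 - w1) ^+ 2 + (v2 - w2) ^+ 2 <= 2).
  by rewrite ler_sqrt// -!rmorphXn -rmorphD (ler_int R _ 2).
split=> [[[-> ->]|[_ le2]]|/and4P[x1 x2 y1 y2]].
- lia.
- by apply/and4P; split; nia.
have [eq|ne] := pselect ((w1, w2) = (v1, v2)); [by left|right].
split; first by move=> eq; apply: ne.
have : (v1 - w1) ^+ 2 <= 1 by nia.
have : (v2 - w2) ^+ 2 <= 1 by nia.
lia.
Qed.

Lemma card_set2_le (T : Type) (u v : T) : [set u; v] #<= `I_2.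
Proof.
have -> : [set u; v] = (fun n => if n == 0%N then u else v) @` `I_2.
  apply/seteqP; split=> [x [->|->]|_ [[|n] _ <-]].
  - by exists 0%N.
  - by exists 1%N.
  - by left.
  - by right.
exact: card_image_le.
Qed.

Lemma separated_pairs (R : realType) (C : set (int * int))
    (a b c d : int * int) :
  identifying_code (king_adj R) 2 C ->
  [set a; b] <> [set c; d] ->
  exists2 w, w \in C &
    ~ ((closed_nbhd (king_adj R) a w \/ closed_nbhd (king_adj R) b w) <->
       (closed_nbhd (king_adj R) c w \/ closed_nbhd (king_adj R) d w)).
Proof.
move=> codeC ne; apply: contrapT => none.
apply: (codeC _ _ (card_set2_le a b) (card_set2_le c d) ne).
apply/seteqP; split=> w [[v vX vw] Cw]; split=> //.
  have : closed_nbhd (king_adj R) c w \/ closed_nbhd (king_adj R) d w.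
    apply: contrapT => h; apply: none; exists w; first exact: mem_set.
    by move=> [+ _]; move=> /(_ _)/h; apply; case: vX => <-; [left|right].
  by case=> ?; [exists c; first left|exists d; first right].
have : closed_nbhd (king_adj R) a w \/ closed_nbhd (king_adj R) b w.
  apply: contrapT => h; apply: none; exists w; first exact: mem_set.
  by move=> [_]; move=> /(_ _)/h; apply; case: vX => <-; [left|right].
by case=> ?; [exists a; first left|exists b; first right].
Qed.

Lemma code_column (R : realType) (C : set (int * int)) (x y : int) :
  identifying_code (king_adj R) 2 C ->
  [|| (x, y) \in C, (x, y + 1) \in C | (x, y + 2) \in C].
Proof.
move=> codeC.
(* The two neighbourhoods differ exactly in the three cells of column [x]. *)
have [] := @separated_pairs R C
  (x - 2, y + 1) (x - 1, y + 1)
  (x - 2, y + 1) (x - 2, y + 1) codeC.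
  rewrite setUid => /seteqP[/(_ (x - 1, y + 1))].
  by move=> /(_ (or_intror erefl))[]; lia.
move=> [p q] Cw; rewrite !king_nbhd/= => h.
have px : p = x by lia.
have : (q == y) || (q == y + 1) || (q == y + 2) by lia.
by case/orP=> [/orP[]|] /eqP qy; subst p q; rewrite Cw ?orbT.
Qed.

Lemma code_row (R : realType) (C : set (int * int)) (x y : int) :
  identifying_code (king_adj R) 2 C ->
  [|| (x, y) \in C, (x + 1, y) \in C | (x + 2, y) \in C].
Proof.
move=> codeC.
have [] := @separated_pairs R C
  (x + 1, y - 2) (x + 1, y - 1)
  (x + 1, y - 2) (x + 1, y - 2) codeC.
  rewrite setUid => /seteqP[/(_ (x + 1, y - 1))].
  by move=> /(_ (or_intror erefl))[]; lia.
move=> [p q] Cw; rewrite !king_nbhd/= => h.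
have px : q = y by lia.
have : (p == x) || (p == x + 1) || (p == x + 2) by lia.
by case/orP=> [/orP[]|] /eqP qy; subst p q; rewrite Cw ?orbT.
Qed.

(** The two diagonals of the central 2x2 square have neighbourhoods that differ exactly in the
    corners of the 4x4 square. *)
Lemma code_corners (R : realType) (C : set (int * int)) (x y : int) :
  identifying_code (king_adj R) 2 C ->
  [|| (x, y) \in C, (x, y + 3) \in C, (x + 3, y) \in C | (x + 3, y + 3) \in C].
Proof.
move=> codeC.
have [] := @separated_pairs R C
  (x + 1, y + 1) (x + 2, y + 2)
  (x + 1, y + 2) (x + 2, y + 1) codeC.
  by move=> /seteqP[/(_ (x + 1, y + 1))] /(_ (or_introl erefl))[] []; lia.
move=> [p q] Cw; rewrite !king_nbhd/= => h.
have : (p == x) || (p == x + 3) by lia.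
have : (q == y) || (q == y + 3) by lia.
by case/orP=> /eqP qy /orP[] /eqP qx; subst p q; rewrite Cw ?orbT.
Qed.

(** * The weight of the code in a window *)

Local Open Scope nat_scope.

Lemma admissible_mkseq (u : nat -> nat -> bool) :
  (forall j i, ~~ [&& u j i, u j i.+1 & u j i.+2]) ->
  (forall j i, ~~ [&& u j i, u j.+1 i & u j.+2 i]) ->
  (forall j i, ~~ [&& u j i, u j i.+3, u j.+3 i & u j.+3 i.+3]) ->
  admissible (fun j => mkseq (u j) 5).
Proof.
move=> col row cor; split=> j; first exact: size_mkseq.
- by rewrite /no_run3 /= !(negbTE (col _ _)).
- by rewrite /= !(negbTE (row _ _)).
- by rewrite /= -!andbA !(negbTE (cor _ _)).
Qed.

Definition cell_weight (j i : nat) : nat := nth 0%num (nth [::] window j) i.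

Lemma sum_cell_weight : \sum_(j < 13) \sum_(i < 5) cell_weight j i = 1506.
Proof. by rewrite !big_ord_recl !big_ord0. Qed.

Lemma window_bound (u : nat -> nat -> bool) :
  admissible (fun j => mkseq (u j) 5) ->
  638 <= \sum_(j < 13) \sum_(i < 5) ~~ u (j + 3) i * cell_weight j i.
Proof.
move=> adm; have := total_window adm.
have : total window (fun j => mkseq (u j) 5) =
    \sum_(j < 13) \sum_(i < 5) u (j + 3) i * cell_weight j i :> nat.
  rewrite total_sum//.
  by apply: eq_bigr => j _; apply: eq_bigr => i _; rewrite nth_mkseq.
have := sum_cell_weight.
have -> : \sum_(j < 13) \sum_(i < 5) cell_weight j i =
    \sum_(j < 13) \sum_(i < 5) u (j + 3) i * cell_weight j i +
    \sum_(j < 13) \sum_(i < 5) ~~ u (j + 3) i * cell_weight j i.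
  rewrite -big_split; apply: eq_bigr => j _ /=.
  rewrite -big_split; apply: eq_bigr => i _ /=.
  by rewrite -mulnDl; case: (u _ _); rewrite mul1n.
lia.
Qed.

Lemma code_window (R : realType) (C : set (int * int)) (x y : int) :
  identifying_code (king_adj R) 2 C ->
  638 <= \sum_(j < 13) \sum_(i < 5)
    ((x + j%:Z, y + i%:Z)%R \in C) * cell_weight j i.
Proof.
move=> codeC.
(* The shift by 3 makes column 3 of [u], the first one counted by [total], the column [x]. *)
pose u (j i : nat) : bool := (x - 3 + j%:Z, y + i%:Z)%R \notin C.
have adm : admissible (fun j => mkseq (u j) 5).
  apply: admissible_mkseq => j i; rewrite /u.
  - rewrite -[i.+2]addn2 -[i.+1]addn1 !PoszD !addrA -!negb_or negbK.
    exact: code_column _ _ codeC.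
  - rewrite -[j.+2]addn2 -[j.+1]addn1 !PoszD !addrA -!negb_or negbK.
    exact: code_row _ _ codeC.
  - rewrite -[i.+3]addn3 -[j.+3]addn3 !PoszD !addrA -!negb_or negbK.
    exact: code_corners _ _ codeC.
apply: leq_trans (window_bound adm) _.
apply: leq_sum => j _; apply: leq_sum => i _.
by rewrite negbK PoszD addrACA -[(- 3)%R]opprK subrr addr0.
Qed.

(** * Averaging over translates *)

Lemma count_square (C : set (int * int)) n :
  #|` fset_set (C `&` square n)| =
  \sum_(i < n.*2.+1) \sum_(j < n.*2.+1) ((i%:Z - n%:Z, j%:Z - n%:Z)%R \in C).
Proof.
pose s := [seq (i%:Z - n%:Z, j%:Z - n%:Z)%R | i <- index_iota 0 n.*2.+1,
                j <- index_iota 0 n.*2.+1].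
have us : uniq s.
  apply: allpairs_uniq; [exact: iota_uniq..|].
  by move=> [a b] [c d] _ _ [] /= ? ?; congr pair; lia.
have -> : #|` fset_set (C `&` square n)| = size [seq v <- s | v \in C].
  apply: perm_size; apply: uniq_perm; [exact: fset_uniq|exact: filter_uniq|].
  move=> [a b]; rewrite in_fset_set; last first.
    by apply: finite_setIr; exact: finite_square.
  rewrite in_setI mem_filter; congr andb.
  apply/idP/allpairsP => [|[[i j] []]].
    rewrite inE /square /= => -[ha hb].
    exists (`|(a + n%:Z)%R|, `|(b + n%:Z)%R|); rewrite !mem_index_iota /=.
    by split; [lia|lia|congr pair; lia].
  rewrite !mem_index_iota /= => hi hj [-> ->]; rewrite inE /square /=; lia.
rewrite size_filter -sum1_count big_mkcond big_allpairs_dep /=.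
rewrite big_mkord.
apply: eq_bigr => i _; rewrite big_mkord; apply: eq_bigr => j _.
by case: (_ \in C).
Qed.

Lemma leq_sum_shift (F : nat -> nat) n k j : j <= k ->
  \sum_(i < n) F (i + j) <= \sum_(i < n + k) F i.
Proof.
move=> jk; rewrite -!(big_mkord xpredT F).
rewrite -(big_mkord xpredT (fun i => F (i + j))).
rewrite [leqRHS](@big_cat_nat _ _ _ j)//=; last first.
  by rewrite (leq_trans jk) ?leq_addl.
rewrite [X in _ + X](@big_cat_nat _ _ _ (n + j))//= ?leq_addl ?leq_add2l//.
by rewrite -{3}[j]add0n big_addn addnK addnCA leq_addr.
Qed.

Lemma exchange_big4 m n p q (F : nat -> nat -> nat -> nat -> nat) :
  \sum_(x < m) \sum_(y < n) \sum_(j < p) \sum_(i < q) F x y j i =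
  \sum_(j < p) \sum_(i < q) \sum_(x < m) \sum_(y < n) F x y j i.
Proof.
transitivity (\sum_(x < m) \sum_(j < p) \sum_(i < q) \sum_(y < n) F x y j i).
  apply: eq_bigr => x _; rewrite exchange_big.
  by apply: eq_bigr => j _; exact: exchange_big.
by rewrite exchange_big; apply: eq_bigr => j _; exact: exchange_big.
Qed.

(** Double counting: after the sums are exchanged, each cell weight multiplies the number of code
    cells in a translate of a square of side [2n + 1], and all these translates lie in the larger
    square. *)
Lemma square_count_bound (R : realType) (C : set (int * int)) n :
  identifying_code (king_adj R) 2 C ->
  638 * n.*2.+1 ^ 2 <= 1506 * #|` fset_set (C `&` square (n + 6))|.
Proof.
move=> codeC; set c := fun x y : nat =>
  ((x%:Z - (n + 6)%:Z, y%:Z - (n + 6)%:Z)%R \in C : nat).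
have -> : 638 * n.*2.+1 ^ 2 = \sum_(x < n.*2.+1) \sum_(y < n.*2.+1) 638.
  by rewrite !(sum_nat_const, card_ord); lia.
apply: (@leq_trans (\sum_(x < n.*2.+1) \sum_(y < n.*2.+1)
    \sum_(j < 13) \sum_(i < 5) c (x + j) (y + i) * cell_weight j i)).
  apply: leq_sum => x _; apply: leq_sum => y _.
  apply: leq_trans (code_window _ _ codeC) _.
  apply: leq_sum => j _; apply: leq_sum => i _; rewrite /c !PoszD.
  apply/eq_leq; congr ((_ \in C) * _); congr pair; exact: addrAC.
rewrite (exchange_big4 _ _ _ _
  (fun x y j i => c (x + j) (y + i) * cell_weight j i)).
rewrite count_square -[in leqRHS]sum_cell_weight big_distrl/=.
apply: leq_sum => j _; rewrite big_distrl/=; apply: leq_sum => i _.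
under eq_bigr do rewrite -big_distrl/=.
rewrite -big_distrl/= mulnC leq_mul2l; apply/orP; right.
(* The margin 6 on each side leaves room for the largest column offset, 12; row offsets reach only
   4. *)
have -> : (n + 6).*2.+1 = n.*2.+1 + 12 by lia.
have j12 : j <= 12 by rewrite -ltnS.
have i12 : i <= 12 by rewrite (leq_trans (ltnW (ltn_ord i))).
apply: leq_trans (leq_sum_shift
  (fun x => \sum_(y < n.*2.+1 + 12) c x y) n.*2.+1 j12).
apply: leq_sum => x _; exact: leq_sum_shift (fun y => c (x + j) y) _ _ _ i12.
Qed.

(** * Passage to the density *)

Lemma limn_esup_ge (R : realType) (u : nat -> \bar R) (l : \bar R) N :
  (forall n, N <= n -> (l <= u n)%E) -> (l <= limn_esup u)%E.
Proof.
move=> lu; rewrite limn_esup_lim; apply: lime_ge; first exact: is_cvg_esups.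
near=> n; apply: le_trans (lu (maxn n N) (leq_maxr _ _)) _.
by apply: ereal_sup_ubound; exists (maxn n N) => //=; rewrite leq_maxl.
Unshelve. all: by end_near. Qed.

Theorem theorem9 (R : realType) (C : set (int * int)) :
  identifying_code (king_adj R) 2 C ->
  (((47%:R / 111%:R : R)%R)%:E <= density R C)%E.
Proof.
move=> codeC; apply: (@limn_esup_ge _ _ _ (31 * 1000)) => n n_large.
have card_square : #|` fset_set (square n)| = n.*2.+1 ^ 2.
  rewrite -[square n]setTI count_square.
  under eq_bigr do under eq_bigr do rewrite in_setT.
  by rewrite !(sum_nat_const, card_ord) muln1.
rewrite card_square lee_fin ler_pdivlMr ?ltr0n ?expn_gt0// mulrAC.
rewrite ler_pdivrMr ?ltr0n// -!natrM ler_nat.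
have [k -> k_large] : exists2 k, n = k + 6 & 30 * 1000 <= k.
  by exists (n - 6); lia.
have := square_count_bound k codeC.
(* With [m = 2k + 1] it suffices that [47 * 1506 * (m + 12) ^ 2 <= 111 * 638 * m ^ 2]. As
   [111 * 638 - 47 * 1506 = 36], this holds once [m] exceeds about 47200, and here [m > 60000]. *)
move: #|` _| => s; nia.
Qed.
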